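(* Let $x_1,x_2,x_3,x_4\in\mathbb{R}^3$ be the vertices of an edge-tangential tetrahedron, i.e. a tetrahedron for which there exists a sphere touching all six of its edges. Then the Atiyah determinant $\det M_4$ of $(x_1,x_2,x_3,x_4)$ satisfies $$|\det M_4|^2\;\geq\;\prod_{\{i<j<k\}\subset\{1,2,3,4\}}\big(d_3(r_{ij},r_{ik},r_{jk})+8\,r_{ij}r_{ik}r_{jk}\big).$$
   Context: For distinct points $x_1,\dots,x_4\in\mathbb{R}^3$ let $r_{ij}=|x_i-x_j|$ and $v_{ij}=(x_j-x_i)/|x_j-x_i|$ for $i\neq j$. Put $d_3(a,b,c)=(a+b-c)(b+c-a)(c+a-b)$. ''Touching an edge'' means that the sphere is tangent to the edge at a point of the edge (the $1$-skeleton of the tetrahedron has an inscribed sphere). Atiyah determinant: for $(a,b)\in\mathbb{C}^2$ with $|a|^2+|b|^2=1$ associate the unit vector $(2\,\mathrm{Re}(a\bar b),\,2\,\mathrm{Im}(a\bar b),\,|a|^2-|b|^2)\in S^2$ (this realizes $\mathbb{CP}^1\cong S^2$ by stereographic projection, the point of the Riemann sphere being $t=a/b$). For $i<j$ choose a unit vector $(a_{ij},b_{ij})\in\mathbb{C}^2$ associated with $v_{ij}$ and put $(a_{ji},b_{ji})=(-\overline{b_{ij}},\,\overline{a_{ij}})$, which is associated with $v_{ji}=-v_{ij}$. For $1\le i\le 4$ let $$p_i(t)=\prod_{j\neq i}(b_{ij}t-a_{ij})=\sum_{m=1}^{4}d_{im}t^{m-1},$$ a polynomial with roots $t_{ij}=a_{ij}/b_{ij}$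 (a root at $\infty$ if $b_{ij}=0$). The Atiyah determinant is $$\det M_4=\Big(\prod_{1\le i<j\le 4}2r_{ij}\Big)\det(d_{im})_{1\le i,m\le 4},$$ which does not depend on the choices of the $(a_{ij},b_{ij})$. *)

(* Defs.v *)
From mathcomp Require Import all_boot all_order all_algebra.
From mathcomp Require Import reals complex.

Set Implicit Arguments.
Unset Strict Implicit.
Unset Printing Implicit Defensive.

Import Order.TTheory GRing.Theory Num.Theory.
Local Open Scope ring_scope.
Local Open Scope complex_scope.

Section Euclidean.
Variable R : realType.
Implicit Types x y c p u v : 'rV[R]_3.

Definition dot u v : R := \sum_(k < 3) u 0 k * v 0 k.

(* The Euclidean norm; the norm that MathComp-Analysis puts on matrices is the
   sup norm. *)
Definition enorm u : R := Num.sqrt (dot u u).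

Definition dist x y : R := enorm (x - y).

(* The unit vector pointing from x to y. *)
Definition direction x y : 'rV[R]_3 := (dist y x)^-1 *: (y - x).

Definition segment x y p : Prop :=
  exists2 s : R, 0 <= s <= 1 & p = x + s *: (y - x).

(* The sphere of center c and radius rho is tangent to the line xy at a point p
   of the closed segment [x, y]: p is on the sphere, and the direction of the
   line lies in the tangent plane of the sphere at p. *)
Definition sphere_touches_edge c (rho : R) x y : Prop :=
  exists p, [/\ segment x y p, dist p c = rho & dot (p - c) (y - x) = 0].

(* Four affinely independent points. *)
Definition tetrahedron (x : 'I_4 -> 'rV[R]_3) : Prop :=
  row_free (\matrix_(i < 3) (x (lift ord0 i) - x ord0)).

Definition edge_tangential (x : 'I_4 -> 'rV[R]_3) : Prop :=
  tetrahedron x /\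
  exists (c : 'rV[R]_3) (rho : R), 0 < rho /\
    forall i j : 'I_4, (i < j)%N -> sphere_touches_edge c rho (x i) (x j).

Definition d3 (a b c : R) : R := (a + b - c) * (b + c - a) * (c + a - b).

End Euclidean.

Section Atiyah.
Variable R : realType.

(* The point of the unit sphere associated with a unit vector (a, b) of C^2. *)
Definition sphere_point (a b : R[i]) : 'rV[R]_3 :=
  \row_(k < 3) [:: 2 * complex.Re (a * conjc b);
                   2 * complex.Im (a * conjc b);
                   complex.Re (`|a| ^+ 2 - `|b| ^+ 2)]`_k.

(* (a, b) is an admissible choice of homogeneous coordinates of the directions
   between the points of x; the diagonal entries a i i, b i i are irrelevant. *)
Definition direction_lift (x : 'I_4 -> 'rV[R]_3) (a b : 'I_4 -> 'I_4 -> R[i]) :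
    Prop :=
  forall i j : 'I_4, (i < j)%N ->
    [/\ `|a i j| ^+ 2 + `|b i j| ^+ 2 = 1,
        sphere_point (a i j) (b i j) = direction (x i) (x j),
        a j i = - conjc (b i j) &
        b j i = conjc (a i j)].

Definition atiyah_poly (a b : 'I_4 -> 'I_4 -> R[i]) (i : 'I_4) : {poly R[i]} :=
  \prod_(j < 4 | j != i) (b i j *: 'X - (a i j)%:P).

(* The column index m ranges over 0, ..., 3, so that the entry (i, m) is the
   coefficient of t^m. *)
Definition atiyah_det (x : 'I_4 -> 'rV[R]_3) (a b : 'I_4 -> 'I_4 -> R[i]) :
    R[i] :=
  (\prod_(i < 4) \prod_(j < 4 | (i < j)%N) (2 * dist (x i) (x j)))%:C
  * \det (\matrix_(i < 4, m < 4) (atiyah_poly a b i)`_m).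

End Atiyah.

(* Main.v *)
Require Import Defs.
From mathcomp Require Import all_boot all_order all_algebra.
From mathcomp Require Import reals complex.
From mathcomp Require Import ring lra.

Set Implicit Arguments.
Unset Strict Implicit.
Unset Printing Implicit Defensive.

Import Order.TTheory GRing.Theory Num.Theory.
Local Open Scope ring_scope.
Local Open Scope complex_scope.

(** The proof bounds [|D|^2] below by [(Re D)^2], where [D] is the Atiyah
    determinant, and computes [Re D] exactly.

    The determinant is a sum of products of six factors, one for each edge,
    and the factor of the edge [ij] is an entry of the rank one matrix formed
    by the two spinors [u_ij] and [u_ji].  Up to a change of basis this matrix
    is [(1 + v . sigma) / 2], with [v] the direction of the edge and [sigma]
    the Pauli matrices, so [D] is a polynomial in the lengths [r_ij] and the
    coordinates of the edge vectors [w_ij = x_j - x_i], of degree one in each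
    edge.  Complex conjugation exchanges the spinors with their conjugates,
    and [D + conj D] is invariant under rotations and reflections: it is a
    polynomial in the lengths and in the scalar products of edge vectors
    ([real_form], [spinor_det_add_conj], [Re_atiyah_det]).  In terms of
    [h_ijk = r_ij r_ik + w_ij . w_ik] it has only twelve terms.

    If a sphere touches the edges, the tangents from the vertex [x_i] have a
    common length [tau_i], and [r_ij = tau_i + tau_j] ([tangent_length]).  Then
    [h_ijk = 2 tau_i (tau_i + tau_j + tau_k)], and [Re D] becomes
    [64 (e1 e2 e3 - 2 e3^2 + 6 e2 e4)] with [e1, .., e4] the elementary
    symmetric functions of the [tau_i] ([real_form_tangent]).  On the other
    side, a face with tangent lengths [p, q, s] contributes
    [8 (p q s + (p + q) (q + s) (s + p)) = 8 (p + q + s) (p q + q s + s p)],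
    and the product over the faces is
    [64^2 (e1^2 e2 - e1 e3 + e4) (e2 e3^2 - e1 e3 e4 + e4^2)].

    The resulting polynomial inequality fails for arbitrary nonnegative
    [tau_i]: it needs the condition [e3^2 <= 4 e2 e4], which says that the
    squared volume is nonnegative ([gram_ge0]).  Given that condition it
    follows from Newton-type inequalities ([esym_ineq]). *)

(** * The polynomial inequality *)

Section ElementarySymmetric.
Variable K : comNzRingType.
Implicit Types p q s t : K.

Definition esym1 p q s t := p + q + s + t.
Definition esym2 p q s t := p * q + p * s + p * t + q * s + q * t + s * t.
Definition esym3 p q s t := p * q * s + p * q * t + p * s * t + q * s * t.
Definition esym4 p q s t := p * q * s * t.

End ElementarySymmetric.

Ltac nonneg :=
  do ![exact: sqr_ge0 | exact: exprn_ge0 | assumption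
      | apply: addr_ge0 | apply: mulr_ge0].

Section Inequality.
Variables (R : realFieldType) (p q s t : R).
Hypotheses (p0 : 0 <= p) (q0 : 0 <= q) (s0 : 0 <= s) (t0 : 0 <= t).

Let e1 := esym1 p q s t.
Let e2 := esym2 p q s t.
Let e3 := esym3 p q s t.
Let e4 := esym4 p q s t.

Lemma esym1_sqr_ge : 0 <= 3 * e1 ^+ 2 - 8 * e2.
Proof.
suff -> : 3 * e1 ^+ 2 - 8 * e2 =
    (p - q) ^+ 2 + (p - s) ^+ 2 + (p - t) ^+ 2
  + (q - s) ^+ 2 + (q - t) ^+ 2 + (s - t) ^+ 2 by nonneg.
by rewrite /e1 /e2 /esym1 /esym2; ring.
Qed.

Lemma esym12_ge : 0 <= e1 * e2 - 6 * e3.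
Proof.
suff -> : e1 * e2 - 6 * e3 =
    (p * ((q - s) ^+ 2 + (q - t) ^+ 2 + (s - t) ^+ 2)
   + q * ((p - s) ^+ 2 + (p - t) ^+ 2 + (s - t) ^+ 2)
   + s * ((p - q) ^+ 2 + (p - t) ^+ 2 + (q - t) ^+ 2)
   + t * ((p - q) ^+ 2 + (p - s) ^+ 2 + (q - s) ^+ 2)) / 2.
  by apply: divr_ge0; [nonneg | ].
by rewrite /e1 /e2 /e3 /esym1 /esym2 /esym3; field.
Qed.

Lemma esym13_ge : 0 <= e1 * e3 - 16 * e4.
Proof.
suff -> : e1 * e3 - 16 * e4 =
    p * q * (s - t) ^+ 2 + p * s * (q - t) ^+ 2 + p * t * (q - s) ^+ 2
  + q * s * (p - t) ^+ 2 + q * t * (p - s) ^+ 2 + s * t * (p - q) ^+ 2.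
  by nonneg.
by rewrite /e1 /e3 /e4 /esym1 /esym3 /esym4; ring.
Qed.

(** The leading terms [e1^2 e2^2 e3^2] of the two sides cancel.  In the difference
    the hypothesis makes [12 e1 e2^2 e3 e4 - 3 e1 e2 e3^3] nonnegative.  The
    part [4 e3^4 - 25 e2 e3^2 e4 + 36 e2^2 e4^2] can be negative, but it is at
    least [- 49/16 e2^2 e4^2], the value at [8 e3^2 = 25 e2 e4].  By the three
    inequalities above, [e1^3 e2 e3 e4] outweighs this and all other negative
    terms. *)
Lemma esym_ineq : e3 ^+ 2 <= 4 * e2 * e4 ->
  (e1 ^+ 2 * e2 - e1 * e3 + e4) * (e2 * e3 ^+ 2 - e1 * e3 * e4 + e4 ^+ 2)
  <= (e1 * e2 * e3 - 2 * e3 ^+ 2 + 6 * e2 * e4) ^+ 2.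
Proof.
move=> vol; move: esym1_sqr_ge esym12_ge esym13_ge.
have [] : [/\ 0 <= e1, 0 <= e2, 0 <= e3 & 0 <= e4].
  by split; rewrite /e1 /e2 /e3 /e4 /esym1 /esym2 /esym3 /esym4; nonneg.
move: e1 e2 e3 e4 vol => f1 f2 f3 f4 vol f1_ge0 f2_ge0 f3_ge0 f4_ge0.
move=> n11 n12 n13.
have volM : 0 <= f1 * f2 * f3 * (4 * f2 * f4 - f3 ^+ 2).
  by rewrite mulr_ge0 ?subr_ge0 //; nonneg.
have n13M : 0 <= f1 ^+ 2 * f2 * f4 * (f1 * f3 - 16 * f4) by nonneg.
have n12M : 0 <= f1 ^+ 2 * f3 * f4 * (f1 * f2 - 6 * f3) by nonneg.
have n11M : 0 <= f2 * f4 ^+ 2 * (3 * f1 ^+ 2 - 8 * f2) by nonneg.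
have n13M' : 0 <= f4 ^+ 2 * (f1 * f3 - 16 * f4) by nonneg.
have min_ge0 : 0 <= (8 * f3 ^+ 2 - 25 * f2 * f4) ^+ 2 by nonneg.
have f4X_ge0 : 0 <= f4 ^+ 3 by nonneg.
have f124_ge0 : 0 <= f1 ^+ 2 * f2 * f4 ^+ 2 by nonneg.
have f134_ge0 : 0 <= f1 ^+ 2 * f3 ^+ 2 * f4 by nonneg.
have f134'_ge0 : 0 <= f1 * f3 * f4 ^+ 2 by nonneg.
lra.
Qed.

End Inequality.

(** * The determinant of four products of three linear forms *)

Section SpinorDet.
Variables (T : eqType) (K : comNzRingType).
Implicit Types (a b r : T -> T -> K) (d : T -> T -> T -> T -> K) (p q s t : T).

(** The coefficients of the product of the linear forms [b p x *: 'X - a p x]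
    for [x] in [q, s, t]. *)
Definition cubic_coef a b p q s t : nat -> K :=
  nth 0 [:: - (a p q * a p s * a p t);
      a p q * a p s * b p t + a p q * b p s * a p t + b p q * a p s * a p t;
      - (a p q * b p s * b p t + b p q * a p s * b p t + b p q * b p s * a p t);
      b p q * b p s * b p t].

(** Written out, so that the statements below are identities of polynomials. *)
Definition det4 (f g h k : nat -> K) : K :=
  let d2 i j := h i * k j - h j * k i in
  let d3 i j l := g i * d2 j l - g j * d2 i l + g l * d2 i j in
  f 0%N * d3 1 2 3 - f 1%N * d3 0 2 3 + f 2%N * d3 0 1 3 - f 3%N * d3 0 1 2.

Definition spinor_det a b p q s t : K :=
  det4 (cubic_coef a b p q s t) (cubic_coef a b q p s t)
       (cubic_coef a b s p q t) (cubic_coef a b t p q s).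

(** The real part of the Atiyah determinant of the vertices [p, q, s, t], where
    [r i j] is the length of the edge vector from [i] to [j] and [d i j k l] the
    scalar product of the edge vectors from [i] to [j] and from [k] to [l].
    Each [turn l i j k] goes once around the face [i j k]; its factor at the
    vertex [i] is [2 r_il r_ij] times the squared cosine of half of the angle
    between the edges to the apex [l] and to the next vertex [j].  The
    six edges of the tetrahedron occur once each in such a product. *)
Definition real_form r d p q s t : K :=
  let h i j k := r i j * r i k + d i j i k in
  let turn l i j k := h i l j * h j l k * h k l i in
  4 * (turn p q s t + turn p q t s + turn q p s t + turn q p t s
     + turn s p q t + turn s p t q + turn t p q s + turn t p s q)
  - 8 * (r p q * r p s * r p t * r q s * r q t * r s t)
  + 8 * (d p q s t * d p s q t * r p t * r q s
       - d p q s t * d p t q s * r p s * r q t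
       + d p s q t * d p t q s * r p q * r s t).

(** The relation between the coordinates of [u_ij] and [u_ji], where [a'] and
    [b'] play the role of the complex conjugates of [a] and [b].  They are
    independent variables here, which makes conjugation the exchange of
    [a, b] with [a', b']. *)
Definition antipodal a b a' b' i j : Prop :=
  [/\ a j i = - b' i j, b j i = a' i j, a' j i = - b i j & b' j i = a i j].

(** The spinor [(a, b)] represents the vector [(x, y, z)] with [x + i y = 2 a b'],
    [x - i y = 2 a' b] and [z = a a' - b b'], of length [a a' + b b']; the
    second argument of [real_form] is the scalar product of two such vectors.
    The factor 32 is [2^6 / 2]: six edge matrices [(r + w . sigma) / 2], and
    twice the real part on the left. *)
Lemma spinor_det_add_conj a b a' b' p q s t :
  antipodal a b a' b' p q -> antipodal a b a' b' p s ->
  antipodal a b a' b' p t -> antipodal a b a' b' q s ->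
  antipodal a b a' b' q t -> antipodal a b a' b' s t ->
  32 * (spinor_det a b p q s t + spinor_det a' b' p q s t) =
  real_form (fun i j => a i j * a' i j + b i j * b' i j)
   (fun i j k l =>
      (a i j * a' i j - b i j * b' i j) * (a k l * a' k l - b k l * b' k l)
      + 2 * (a i j * b' i j * a' k l * b k l + a' i j * b i j * a k l * b' k l))
   p q s t.
Proof.
rewrite /spinor_det /real_form /det4 /cubic_coef /=.
move=> [-> -> -> ->] [-> -> -> ->] [-> -> -> ->].
move=> [-> -> -> ->] [-> -> -> ->] [-> -> -> ->].
ring.
Qed.

(** Each term of [real_form] has degree one in each edge.  With [rho] equal to 1
    this says that only the values at distinct vertices matter. *)
Lemma real_form_scale rho r r' d d' p q s t :
  uniq [:: p; q; s; t] ->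
  (forall i j, i != j -> rho i j = rho j i) ->
  (forall i j, i != j -> r i j = rho i j * r' i j) ->
  (forall i j k l, i != j -> k != l ->
     d i j k l = rho i j * rho k l * d' i j k l) ->
  real_form r d p q s t =
  rho p q * rho p s * rho p t * rho q s * rho q t * rho s t
  * real_form r' d' p q s t.
Proof.
rewrite /= !inE !negb_or andbT.
case/and3P => /and3P[pq ps pt] /andP[qs qt] st rhoC rE dE.
have [qp sp tp] : [/\ q != p, s != p & t != p] by split; rewrite eq_sym.
have [sq tq ts] : [/\ s != q, t != q & t != s] by split; rewrite eq_sym.
rewrite /real_form !dE // !rE //.
rewrite (rhoC q p) // (rhoC s p) // (rhoC t p) // (rhoC s q) // (rhoC t q) //.
rewrite (rhoC t s) //; ring.
Qed.

(** Here [r i j * r i k + d i j i k = 2 tau_i (tau_i + tau_j + tau_k)]. *)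
Lemma real_form_tangent (tau : T -> K) r d p q s t :
  uniq [:: p; q; s; t] ->
  (forall i j, i != j -> r i j = tau i + tau j) ->
  (forall i j k, i != j -> i != k -> j != k ->
     d i j i k = tau i * (tau i + tau j + tau k) - tau j * tau k) ->
  (forall i j k l, uniq [:: i; j; k; l] ->
     d i j k l = (tau j - tau i) * (tau k - tau l)) ->
  let e1 := esym1 (tau p) (tau q) (tau s) (tau t) in
  let e2 := esym2 (tau p) (tau q) (tau s) (tau t) in
  let e3 := esym3 (tau p) (tau q) (tau s) (tau t) in
  let e4 := esym4 (tau p) (tau q) (tau s) (tau t) in
  real_form r d p q s t = 64 * (e1 * e2 * e3 - 2 * e3 ^+ 2 + 6 * e2 * e4).
Proof.
move=> /[dup] pqst; rewrite /= !inE !negb_or andbT.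
case/and3P => /and3P[pq ps pt] /andP[qs qt] st rE adjE oppE.
have [qp sp tp] : [/\ q != p, s != p & t != p] by split; rewrite eq_sym.
have [sq tq ts] : [/\ s != q, t != q & t != s] by split; rewrite eq_sym.
have [psqt ptqs] : uniq [:: p; s; q; t] /\ uniq [:: p; t; q; s].
  by rewrite /= !inE !negb_or pq ps pt qs qt st sq tq ts.
rewrite /real_form !rE // !adjE // !oppE // /esym1 /esym2 /esym3 /esym4.
ring.
Qed.

End SpinorDet.

Section Morphism.
Variables (T : eqType) (K L : comNzRingType) (phi : {rmorphism K -> L}).

Lemma rmorph_cubic_coef (a b : T -> T -> K) p q s t m :
  phi (cubic_coef a b p q s t m) =
  cubic_coef (fun i j => phi (a i j)) (fun i j => phi (b i j)) p q s t m.
Proof.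
case: m => [|[|[|[|m]]]];
  by rewrite /cubic_coef /= ?nth_nil ?(rmorph0, rmorphN, rmorphD, rmorphM).
Qed.

Lemma rmorph_spinor_det (a b : T -> T -> K) p q s t :
  phi (spinor_det a b p q s t) =
  spinor_det (fun i j => phi (a i j)) (fun i j => phi (b i j)) p q s t.
Proof.
rewrite /spinor_det /det4 -!rmorph_cubic_coef; ring.
Qed.

Lemma rmorph_real_form (r : T -> T -> K) d p q s t :
  phi (real_form r d p q s t) =
  real_form (fun i j => phi (r i j)) (fun i j k l => phi (d i j k l)) p q s t.
Proof.
rewrite /real_form /=; ring.
Qed.

End Morphism.

(** * Expansion of matrices and products over the vertices *)

Local Notation v0 := (inord 0 : 'I_4).
Local Notation v1 := (inord 1 : 'I_4).
Local Notation v2 := (inord 2 : 'I_4).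
Local Notation v3 := (inord 3 : 'I_4).

Lemma vertex_uniq : uniq [:: v0; v1; v2; v3].
Proof. by rewrite /= !inE -!val_eqE /= !inordK. Qed.

Section Determinant.
Variable K : comNzRingType.

Definition nat_mx n (f : nat -> nat -> K) : 'M[K]_n := \matrix_(i, j) f i j.

(** The minors keep the form [nat_mx], so that the expansion can be iterated. *)
Lemma det_first_row n (f : nat -> nat -> K) :
  \det (nat_mx n.+1 f) =
  \sum_(j < n.+1) (-1) ^+ j * f 0%N j *
     \det (nat_mx n (fun i k => f i.+1 (bump j k))).
Proof.
rewrite (expand_det_row _ ord0); apply: eq_bigr => j _.
rewrite mxE mulrCA mulrA /cofactor add0n; congr (_ * \det _).
by apply/matrixP => i k; rewrite !mxE.
Qed.

Lemma det4E (f : nat -> nat -> K) :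
  \det (nat_mx 4 f) = det4 (f 0) (f 1) (f 2) (f 3).
Proof.
rewrite !(det_first_row, big_ord_recl, big_ord0) !det_mx00 /det4 /bump /=.
ring.
Qed.

Lemma coef_linear_prod (a1 b1 a2 b2 a3 b3 : K) m :
  ((b1 *: 'X - a1%:P) * (b2 *: 'X - a2%:P) * (b3 *: 'X - a3%:P))`_m =
  [:: - (a1 * a2 * a3); a1 * a2 * b3 + a1 * b2 * a3 + b1 * a2 * a3;
      - (a1 * b2 * b3 + b1 * a2 * b3 + b1 * b2 * a3); b1 * b2 * b3]`_m.
Proof.
rewrite -[RHS]coef_Poly; congr ((_ : {poly K})`_m).
rewrite /= !cons_poly_def -!mul_polyC; ring.
Qed.

Lemma prod_vertices (F : 'I_4 -> K) (P : pred 'I_4) :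
  \prod_(i < 4 | P i) F i =
  (if P v0 then F v0 else 1) * (if P v1 then F v1 else 1)
  * (if P v2 then F v2 else 1) * (if P v3 then F v3 else 1).
Proof.
rewrite big_mkcond !big_ord_recl big_ord0 /= mulr1 !mulrA.
have e0 : v0 = ord0 :> 'I_4 by apply: val_inj; rewrite /= inordK.
have e1 : v1 = lift ord0 ord0 :> 'I_4.
  by apply: val_inj; rewrite /= inordK.
have e2 : v2 = lift ord0 (lift ord0 ord0) :> 'I_4.
  by apply: val_inj; rewrite /= inordK.
have e3 : v3 = lift ord0 (lift ord0 (lift ord0 ord0)) :> 'I_4.
  by apply: val_inj; rewrite /= inordK.
by rewrite e0 e1 e2 e3.
Qed.

Lemma prod_pairs (F : 'I_4 -> 'I_4 -> K) :
  \prod_(i < 4) \prod_(j < 4 | (i < j)%N) F i j =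
  F v0 v1 * F v0 v2 * F v0 v3 * F v1 v2 * F v1 v3 * F v2 v3.
Proof. by rewrite !prod_vertices !inordK //=; ring. Qed.

Lemma prod_triples (F : 'I_4 -> 'I_4 -> 'I_4 -> K) :
  \prod_(i < 4) \prod_(j < 4 | (i < j)%N) \prod_(k < 4 | (j < k)%N) F i j k =
  F v0 v1 v2 * F v0 v1 v3 * F v0 v2 v3 * F v1 v2 v3.
Proof. by rewrite !prod_vertices !inordK //=; ring. Qed.

End Determinant.

(** * Lengths and scalar products of edge vectors *)

Section Geometry.
Variable R : realType.
Implicit Types x y z w c u v : 'rV[R]_3.

Lemma dotE u v : dot u v = u 0 0 * v 0 0 + u 0 1 * v 0 1 + u 0 2 * v 0 2.
Proof.
rewrite /dot !big_ord_recl big_ord0 addr0 addrA.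
by congr (_ + u 0 _ * v 0 _ + u 0 _ * v 0 _); apply: val_inj.
Qed.

Lemma dot_ge0 u : 0 <= dot u u.
Proof. by rewrite dotE !addr_ge0 // -expr2 sqr_ge0. Qed.

Lemma dist_ge0 x y : 0 <= dist x y.
Proof. exact: sqrtr_ge0. Qed.

Lemma sqr_dist x y : dist x y ^+ 2 = dot (x - y) (x - y).
Proof. by rewrite sqr_sqrtr ?dot_ge0. Qed.

Lemma distC x y : dist x y = dist y x.
Proof. by rewrite /dist /enorm !dotE !mxE; congr Num.sqrt; ring. Qed.

Lemma dot_dist x y z w :
  2 * dot (y - x) (w - z) =
  dist x w ^+ 2 + dist y z ^+ 2 - dist x z ^+ 2 - dist y w ^+ 2.
Proof. by rewrite !sqr_dist !dotE !mxE; ring. Qed.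

Lemma dot_dist_angle x y z :
  2 * dot (y - x) (z - x) = dist x y ^+ 2 + dist x z ^+ 2 - dist y z ^+ 2.
Proof. by rewrite !sqr_dist !dotE !mxE; ring. Qed.

(** The Gram determinant is the square of a determinant. *)
Lemma gram_ge0 (u v w : 'rV[R]_3) :
  0 <= dot u u * dot v v * dot w w + 2 * dot u v * dot u w * dot v w
       - dot u u * dot v w ^+ 2 - dot v v * dot u w ^+ 2 - dot w w * dot u v ^+ 2.
Proof.
set G := (X in 0 <= X).
suff -> : G = (u 0 0 * (v 0 1 * w 0 2 - v 0 2 * w 0 1)
             - u 0 1 * (v 0 0 * w 0 2 - v 0 2 * w 0 0)
             + u 0 2 * (v 0 0 * w 0 1 - v 0 1 * w 0 0)) ^+ 2 by exact: sqr_ge0.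
by rewrite /G !dotE; ring.
Qed.

(** By Pythagoras the distance from [x] to the point of contact is determined by
    the sphere, and it is the same for all the tangents from [x].  The point of
    contact lies between [x] and [y], so the two tangent lengths add up. *)
Lemma tangent_length c rho x y : sphere_touches_edge c rho x y ->
  dist x y =
  Num.sqrt (dist x c ^+ 2 - rho ^+ 2) + Num.sqrt (dist y c ^+ 2 - rho ^+ 2).
Proof.
move=> [p [[s /andP[s0 s1] ->]] <- orth].
have -> : dist x c ^+ 2 - dist (x + s *: (y - x)) c ^+ 2 = (s * dist x y) ^+ 2.
  rewrite exprMn !sqr_dist; move: orth; rewrite !dotE !mxE => orth.
  transitivity (s ^+ 2 * dot (x - y) (x - y)); last by rewrite dotE !mxE.
  move: orth; rewrite dotE !mxE; nra.
have -> : dist y c ^+ 2 - dist (x + s *: (y - x)) c ^+ 2 =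
    ((1 - s) * dist x y) ^+ 2.
  rewrite exprMn !sqr_dist; move: orth; rewrite !dotE !mxE; nra.
rewrite !sqrtr_sqr !ger0_norm ?mulr_ge0 ?dist_ge0 ?subr_ge0 //; ring.
Qed.

End Geometry.

(** * Spinors and directions *)

Section Sphere.
Variable (R : realType).
Implicit Types a b c d : R[i].

Lemma sphere_pointE a b : sphere_point a b =
  \row_(k < 3) [:: 2 * complex.Re (a * conjc b); 2 * complex.Im (a * conjc b);
                   complex.Re (a * conjc a - b * conjc b)]`_k.
Proof. by rewrite /sphere_point !sqr_normc. Qed.

Lemma dot_sphere_point a b c d :
  (dot (sphere_point a b) (sphere_point c d))%:C =
  (a * conjc a - b * conjc b) * (c * conjc c - d * conjc d)
  + 2 * (a * conjc b * conjc c * d + conjc a * b * c * conjc d).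
Proof.
rewrite !sphere_pointE /dot !big_ord_recl big_ord0 addr0 !mxE /=.
case: a b c d => [a1 a2] [b1 b2] [c1 c2] [d1 d2].
apply/eqP; rewrite eq_complex /=; apply/andP; split; apply/eqP; ring.
Qed.

Lemma sphere_pointN a b : sphere_point (- conjc b) (conjc a) = - sphere_point a b.
Proof.
rewrite !sphere_pointE; apply/rowP => k; rewrite !mxE.
case: a b => [a1 a2] [b1 b2]; case: k => [[|[|[|//]]] kk] /=; ring.
Qed.

End Sphere.

(** * The real part of the Atiyah determinant *)

Section Atiyah.
Variable R : realType.
Variables (x : 'I_4 -> 'rV[R]_3) (a b : 'I_4 -> 'I_4 -> R[i]).

Lemma det_spinor_det :
  \det (\matrix_(i < 4, m < 4) (atiyah_poly a b i)`_m)
  = spinor_det a b v0 v1 v2 v3.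
Proof.
have -> : \matrix_(i < 4, m < 4) (atiyah_poly a b i)`_m =
    nat_mx 4 (fun i m => (atiyah_poly a b (inord i))`_m).
  by apply/matrixP => i m; rewrite !mxE inord_val.
rewrite det4E /spinor_det /det4 /atiyah_poly !prod_vertices.
rewrite -!val_eqE /= !inordK //=.
by rewrite !(mul1r, mulr1) !coef_linear_prod.
Qed.

Lemma atiyah_det_spinor : atiyah_det x a b =
  (64 * (dist (x v0) (x v1) * dist (x v0) (x v2) * dist (x v0) (x v3)
  * dist (x v1) (x v2) * dist (x v1) (x v3) * dist (x v2) (x v3)))%:C
  * spinor_det a b v0 v1 v2 v3.
Proof.
rewrite /atiyah_det det_spinor_det prod_pairs; congr (_%:C * _); ring.
Qed.

Hypothesis hab : direction_lift x a b.

Lemma lift_direction i j : i != j ->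
  a i j * conjc (a i j) + b i j * conjc (b i j) = 1 /\
  sphere_point (a i j) (b i j) = direction (x i) (x j).
Proof.
rewrite -val_eqE neq_ltn => /orP[] /hab[+ dE aE bE]; rewrite !sqr_normc.
  by [].
move=> nE; split; first by rewrite aE bE rmorphN /= !conjcK -nE; ring.
rewrite aE bE sphere_pointN dE /direction distC.
by rewrite -scalerN opprB.
Qed.

Lemma antipodal_conj (i j : 'I_4) : (i < j)%N ->
  antipodal a b (fun i j => conjc (a i j)) (fun i j => conjc (b i j)) i j.
Proof.
by case/hab=> _ _ aE bE; split; rewrite ?aE ?bE ?rmorphN /= ?conjcK.
Qed.

Lemma lift_dist_neq0 i j : i != j -> dist (x j) (x i) != 0.
Proof.
move=> /lift_direction[n1 dE]; apply: contra_eq_neq dE => d0.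
rewrite /direction d0 invr0 scale0r; apply/eqP => s0.
have := dot_sphere_point (a i j) (b i j) (a i j) (b i j).
have -> : dot (sphere_point (a i j) (b i j)) (sphere_point (a i j) (b i j)) = 0.
  by rewrite s0 /dot big1 // => k _; rewrite mxE mul0r.
move=> /esym.
(* The vector associated with [(a, b)] has length [|a|^2 + |b|^2]. *)
rewrite (_ : _ + _ = (a i j * conjc (a i j) + b i j * conjc (b i j)) ^+ 2);
  last by ring.
by rewrite n1 expr1n => /eqP; rewrite oner_eq0.
Qed.

(** The spinor identity gives the real part for unit edge vectors; the prefactor
    [\prod 2 r_ij] of the determinant then restores the lengths, since
    [real_form] has degree one in each edge. *)
Lemma Re_atiyah_det :
  complex.Re (atiyah_det x a b) =
  real_form (fun i j => dist (x i) (x j))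
            (fun i j k l => dot (x j - x i) (x l - x k)) v0 v1 v2 v3.
Proof.
set r := fun i j => _; set d := fun i j k l => _.
pose u i j := direction (x i) (x j).
have key : 32 * (spinor_det a b v0 v1 v2 v3 + conjc (spinor_det a b v0 v1 v2 v3))
   = (real_form (fun _ _ => 1) (fun i j k l => dot (u i j) (u k l)) v0 v1 v2 v3)%:C.
  rewrite rmorph_spinor_det spinor_det_add_conj ?rmorph_real_form;
    try by apply: antipodal_conj; rewrite !inordK.
  rewrite /=.
  rewrite (real_form_scale (rho := fun _ _ => 1) (r' := fun _ _ => 1%:C)
    (d' := fun i j k l => (dot (u i j) (u k l))%:C) vertex_uniq) /= ?mul1r //.
    by move=> i j /lift_direction[-> _].
  move=> i j k l /lift_direction[_ ij] /lift_direction[_ kl].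
  by rewrite /u -ij -kl dot_sphere_point mul1r.
have scale : real_form r d v0 v1 v2 v3 =
   r v0 v1 * r v0 v2 * r v0 v3 * r v1 v2 * r v1 v3 * r v2 v3
   * real_form (fun _ _ => 1) (fun i j k l => dot (u i j) (u k l)) v0 v1 v2 v3.
  apply: real_form_scale vertex_uniq _ _ _ => [i j _|i j _|i j k l ij kl].
  - exact: distC.
  - by rewrite mulr1.
  rewrite /d /u /direction /r (distC (x i)) (distC (x k)).
  have := lift_dist_neq0 ij; have := lift_dist_neq0 kl.
  rewrite !dotE !mxE; move: (dist _ _) (dist _ _) => r1 r2 n1 n2.
  by field; rewrite n1.
have Re2 (z : R[i]) : z + conjc z = (2 * complex.Re z)%:C.
  case: z => z1 z2; apply/eqP; rewrite eq_complex /=.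
  by apply/andP; split; apply/eqP; ring.
rewrite scale atiyah_det_spinor.
move: key; rewrite Re2 => /(congr1 (@complex.Re R)) /= <-.
case: (spinor_det _ _ _ _ _ _) => z1 z2 /=; rewrite /r; ring.
Qed.

End Atiyah.

(** * Tetrahedra with prescribed tangent lengths *)

Section Tangential.
Variables (R : realType) (x : 'I_4 -> 'rV[R]_3) (tau : 'I_4 -> R).
Hypothesis dist_tau :
  forall i j : 'I_4, i != j -> dist (x i) (x j) = tau i + tau j.

Lemma dot_adjacent (i j k : 'I_4) : i != j -> i != k -> j != k ->
  dot (x j - x i) (x k - x i) = tau i * (tau i + tau j + tau k) - tau j * tau k.
Proof.
move=> ij ik jk; have := dot_dist_angle (x i) (x j) (x k).
rewrite !dist_tau //; lra.
Qed.

Lemma dot_opposite (i j k l : 'I_4) : uniq [:: i; j; k; l] ->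
  dot (x j - x i) (x l - x k) = (tau j - tau i) * (tau k - tau l).
Proof.
rewrite /= !inE !negb_or andbT => /and3P[/and3P[ij ik il] /andP[jk jl] kl].
have := dot_dist (x i) (x j) (x k) (x l).
rewrite !dist_tau //; lra.
Qed.

End Tangential.

Unset Implicit Arguments.

Theorem mainTheorem2 (R : realType) (x : 'I_4 -> 'rV[R]_3)
    (a b : 'I_4 -> 'I_4 -> R[i])
    (hx : edge_tangential x) (hab : direction_lift x a b) :
  (\prod_(i < 4) \prod_(j < 4 | (i < j)%N) \prod_(k < 4 | (j < k)%N)
     (d3 (dist (x i) (x j)) (dist (x i) (x k)) (dist (x j) (x k))
      + 8 * dist (x i) (x j) * dist (x i) (x k) * dist (x j) (x k)))%:C
  <= `|atiyah_det x a b| ^+ 2.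
Proof.
have [_ [c [rho [_ touch]]]] := hx.
pose tau i := Num.sqrt (dist (x i) c ^+ 2 - rho ^+ 2).
have tau0 i : 0 <= tau i by exact: sqrtr_ge0.
have distE (i j : 'I_4) : i != j -> dist (x i) (x j) = tau i + tau j.
  rewrite -val_eqE neq_ltn => /orP[/touch/tangent_length //|].
  by rewrite distC addrC => /touch/tangent_length.
have := vertex_uniq; rewrite /= !inE !negb_or andbT.
case/and3P => /and3P[v01 v02 v03] /andP[v12 v13] v23.
rewrite -add_Re2_Im2 (Re_atiyah_det hab) lecR prod_triples.
rewrite (real_form_tangent vertex_uniq distE (dot_adjacent distE)
           (dot_opposite distE)).
rewrite /d3 !distE // -[X in X <= _]addr0.
apply: lerD; last exact: sqr_ge0.
have gram := gram_ge0 (x v1 - x v0) (x v2 - x v0) (x v3 - x v0).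
have self i j : i != j -> dot (x j - x i) (x j - x i) = (tau i + tau j) ^+ 2.
  by move=> ij; rewrite -distE // distC sqr_dist.
rewrite !self // !(dot_adjacent distE) // in gram.
have := @esym_ineq _ _ _ _ _ (tau0 v0) (tau0 v1) (tau0 v2) (tau0 v3).
rewrite /=; move: (tau v0) (tau v1) (tau v2) (tau v3) gram => p q s t gram.
move=> ineq; set lhs := (X in X <= _).
have -> : lhs = 64 ^+ 2 *
    ((esym1 p q s t ^+ 2 * esym2 p q s t - esym1 p q s t * esym3 p q s t
      + esym4 p q s t)
     * (esym2 p q s t * esym3 p q s t ^+ 2
        - esym1 p q s t * esym3 p q s t * esym4 p q s t + esym4 p q s t ^+ 2)).
  by rewrite /lhs /esym1 /esym2 /esym3 /esym4; ring.
rewrite [(64 * _) ^+ 2]exprMn ler_pM2l ?exprn_gt0 ?ltr0n //; apply: ineq.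
(* The Gram determinant of the edges from [v0] is [4 (4 e2 e4 - e3^2)]. *)
rewrite -subr_ge0 -(pmulr_rge0 _ (ltr0n _ 4)).
move: gram; congr (0 <= _); rewrite /esym2 /esym3 /esym4; ring.
Qed.
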